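(* If $\rho_0,\rho_1\in\mathcal D_+$, then $$\inf_{(\rho,v)}\Bigl\{\int_0^1\tfrac12\mathrm{tr}(\rho v^*v)\,dt\ \Big|\ (\rho,v)\in\mathcal C(\rho_0,\rho_1)\Bigr\}=\inf_{(\rho,m)}\Bigl\{\int_0^1F(\rho,m)\,dt\ \Big|\ (\rho,m)\in\tilde{\mathcal C}(\rho_0,\rho_1)\Bigr\}.$$
   Context: Fix integers $n,N\ge1$ and Hermitian matrices $L_1,\dots,L_N\in\mathbb C^{n\times n}$. $\mathcal H$ and $\mathcal S$ denote the real vector spaces of $n\times n$ complex Hermitian, respectively skew-Hermitian, matrices; $\mathcal H_{++}$ is the set of positive definite matrices in $\mathcal H$; $\mathcal D_+=\{\rho\in\mathcal H_{++}:\mathrm{tr}(\rho)=1\}$. $\langle X;Y\rangle=\mathrm{tr}(X^*Y)$. A matrix $m\in\mathbb C^{nN\times n}$ is viewed as a block column with blocks $m_1,\dots,m_N\in\mathbb C^{n\times n}$, and $m_*$ is the block column with blocks $m_1^*,\dots,m_N^*$; $\mathcal S^N$ is the set of block columns with all blocks in $\mathcal S$. For $v\in\mathcal S^N$ and an $n\times n$ matrix $\rho$, $v\rho$ and $\rho v$ are the block columns with blocks $v_k\rho$ and $\rho v_k$. The operator $\nabla_L^*:\mathcal S^N\to\mathcal H$ is $\nabla_L^*Y=\sum_k(L_kY_k-Y_kL_k)$. For $\rho\in\mathcal H_{++}$ and $m\in\mathbb C^{nN\times n}$, $F(\rho,m)=\frac12\langle m;m\rho^{-1}\rangle$; for $v\in\mathcal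 S^N$, $Q_\rho(v)=\mathrm{tr}(\rho v^*v)$. $\mathcal C(\rho_0,\rho_1)$ is the set of pairs $(\rho,v)$ with $\rho\in C^1([0,1],\mathcal D_+)$, $\rho(0)=\rho_0$, $\rho(1)=\rho_1$, $v:(0,1)\to\mathcal S^N$ Borel, $Q_\rho(v)\in L^1(0,1)$, and $\dot\rho=\frac12\nabla_L^*(v\rho+\rho v)$ in the sense of distributions on $(0,1)$. $\tilde{\mathcal C}(\rho_0,\rho_1)$ is the set of pairs $(\rho,m)$ with $\rho\in C^1([0,1],\mathcal D_+)$, $\rho(0)=\rho_0$, $\rho(1)=\rho_1$, $m:(0,1)\to\mathbb C^{nN\times n}$ Borel, $F(\rho,m)\in L^1(0,1)$, and $\dot\rho=\frac12\nabla_L^*(m-m_* )$ in the sense of distributions on $(0,1)$. The infimum of the empty set is $+\infty$. *)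

(* Defs.v *)
From HB Require Import structures.
From mathcomp Require Import all_boot all_order all_algebra.
From mathcomp Require Import all_classical all_reals all_analysis.
From mathcomp Require Import complex.

Set Implicit Arguments.
Unset Strict Implicit.
Unset Printing Implicit Defensive.

Import Order.TTheory GRing.Theory Num.Theory.
Import numFieldNormedType.Exports.

Local Open Scope classical_set_scope.
Local Open Scope sesquilinear_scope.
Local Open Scope complex_scope.
Local Open Scope ring_scope.

Notation hermitianM := (hermitianmx _ false Num.conj).
Notation skewHermitianM := (hermitianmx _ true Num.conj).

Definition inner (R : realType) (p q : nat) (X Y : 'M[R[i]]_(p, q)) : R[i] :=
  \tr (X^t* *m Y).

(* In [R[i]], [0 < z] means that [z] is real and positive. *)
Definition posdefM (R : realType) (n : nat) (A : 'M[R[i]]_n) : Prop :=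
  A \is hermitianM /\
  forall x : 'cV[R[i]]_n, x != 0 -> 0 < (x^t* *m A *m x) 0 0.

Definition densityM (R : realType) (n : nat) (A : 'M[R[i]]_n) : Prop :=
  posdefM A /\ \tr A = 1.

(* [(nN) x n] matrices; the block [m_k] is [submxcol m k]. *)
Notation blockcol R N n := 'M[R[i]]_((\sum_(k < N) n)%N, n).

Definition adj_blocks (R : realType) (N n : nat) (m : blockcol R N n) :
    blockcol R N n :=
  \mxcol_(k < N) (submxcol m k)^t*.

Definition skew_blocks (R : realType) (N n : nat) (v : blockcol R N n) : Prop :=
  forall k : 'I_N, submxcol v k \is skewHermitianM.

(* [rho v]; the column [v rho] is the ordinary product [v *m rho]. *)
Definition lmul_blocks (R : realType) (N n : nat)
    (rho : 'M[R[i]]_n) (v : blockcol R N n) : blockcol R N n :=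
  \mxcol_(k < N) (rho *m submxcol v k).

Definition nablaL_adj (R : realType) (N n : nat) (L : 'I_N -> 'M[R[i]]_n)
    (Y : blockcol R N n) : 'M[R[i]]_n :=
  \sum_(k < N) (L k *m submxcol Y k - submxcol Y k *m L k).

(* The two traces below are real for positive definite [rho]; [complex.Re]
   only changes their type. *)
Definition F_cost (R : realType) (N n : nat)
    (rho : 'M[R[i]]_n) (m : blockcol R N n) : R :=
  2^-1 * complex.Re (inner m (m *m invmx rho)).

Definition Q_form (R : realType) (N n : nat)
    (rho : 'M[R[i]]_n) (v : blockcol R N n) : R :=
  complex.Re (\tr (rho *m (v^t* *m v))).

(* The derivative at [t] is taken within [[0, 1]], hence one-sided at 0, 1. *)
Definition C1_on01 (R : realType) (f : R -> R) : Prop :=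
  exists2 df : R -> R,
    {within `[0, 1], continuous df} &
    forall t : R, `[0, 1]%classic t ->
      (f s - f t) / (s - t) @[s --> within `[0, 1]%classic t^'] --> df t.

Definition test_fun01 (R : realType) (phi : R -> R) : Prop :=
  [/\ forall (k : nat) (t : R), derivable (derive1n k phi) t 1,
      compact (closure [set t | phi t != 0]) &
      closure [set t | phi t != 0] `<=` `]0, 1[%classic].

(* [f' = g] as distributions on [(0, 1)]. *)
Definition distr_deriv01 (R : realType) (f g : R -> R) : Prop :=
  [/\ locally_integrable `]0, 1[%classic f,
      locally_integrable `]0, 1[%classic g &
      forall phi : R -> R, test_fun01 phi ->
        (\int[lebesgue_measure]_(t in `]0%R, 1%R[) (derive1 phi t * f t)%:E =
         - \int[lebesgue_measure]_(t in `]0%R, 1%R[) (phi t * g t)%:E)%E].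

(* Complex matrix-valued versions are read on the real coordinates, i.e. the
   real and imaginary parts of all entries. *)
Definition C1_mx01 (R : realType) (p q : nat) (A : R -> 'M[R[i]]_(p, q)) : Prop :=
  forall (i : 'I_p) (j : 'I_q),
    C1_on01 (fun t => complex.Re (A t i j)) /\
    C1_on01 (fun t => complex.Im (A t i j)).

Definition borel_mx01 (R : realType) (p q : nat)
    (A : R -> 'M[R[i]]_(p, q)) : Prop :=
  forall (i : 'I_p) (j : 'I_q),
    measurable_fun (`]0, 1[%classic : set R) (fun t => complex.Re (A t i j)) /\
    measurable_fun (`]0, 1[%classic : set R) (fun t => complex.Im (A t i j)).

Definition distr_deriv_mx01 (R : realType) (p q : nat)
    (A B : R -> 'M[R[i]]_(p, q)) : Prop :=
  forall (i : 'I_p) (j : 'I_q),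
    distr_deriv01 (fun t => complex.Re (A t i j))
                  (fun t => complex.Re (B t i j)) /\
    distr_deriv01 (fun t => complex.Im (A t i j))
                  (fun t => complex.Im (B t i j)).

Definition L1_01 (R : realType) (f : R -> R) : Prop :=
  (@lebesgue_measure R).-integrable `]0, 1[%classic (EFin \o f).

(* Curves are total functions on [R]; only their values on [[0, 1]] (for
   [rho]) and [(0, 1)] (for [v] and [m]) are constrained or used. *)

Definition density_path (R : realType) (n : nat) (rho0 rho1 : 'M[R[i]]_n)
    (rho : R -> 'M[R[i]]_n) : Prop :=
  [/\ C1_mx01 rho,
      forall t : R, `[0, 1]%classic t -> densityM (rho t),
      rho 0 = rho0 & rho 1 = rho1].

Definition admissible_v (R : realType) (N n : nat) (L : 'I_N -> 'M[R[i]]_n)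
    (rho0 rho1 : 'M[R[i]]_n) :
    set ((R -> 'M[R[i]]_n) * (R -> blockcol R N n)) :=
  [set rv | let rho := rv.1 in let v := rv.2 in
    [/\ density_path rho0 rho1 rho,
        forall t : R, `]0, 1[%classic t -> skew_blocks (v t),
        borel_mx01 v,
        L1_01 (fun t => Q_form (rho t) (v t)) &
        distr_deriv_mx01 rho (fun t =>
          2^-1 *: nablaL_adj L (v t *m rho t + lmul_blocks (rho t) (v t)))]].

Definition admissible_m (R : realType) (N n : nat) (L : 'I_N -> 'M[R[i]]_n)
    (rho0 rho1 : 'M[R[i]]_n) :
    set ((R -> 'M[R[i]]_n) * (R -> blockcol R N n)) :=
  [set rm | let rho := rm.1 in let m := rm.2 in
    [/\ density_path rho0 rho1 rho,
        borel_mx01 m,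
        L1_01 (fun t => F_cost (rho t) (m t)) &
        distr_deriv_mx01 rho (fun t =>
          2^-1 *: nablaL_adj L (m t - adj_blocks (m t)))]].

(* Main.v *)
Require Import Defs.
From mathcomp Require Import all_boot all_order all_algebra.
From mathcomp Require Import all_classical all_reals all_analysis.
From mathcomp Require Import complex measurable_realfun.

(** The substitution [m = v rho] turns a pair [(rho, v)] with skew-Hermitian
    blocks into a pair [(rho, m)] satisfying the same continuity equation,
    because [m_* = - rho v], and with the same cost, because
    [F (rho, v rho) = 1/2 Q_rho v] ([admissible_momentum]).  Hence the second
    infimum is at most the first.

    Conversely, let [(rho, m)] be admissible, fix a time, and let [v_k] be the
    solution of the Lyapunov equation [v_k rho + rho v_k = m_k - m_k^*].  It
    exists and is unique since [rho] is positive definite ([lyap_mx_unit]), and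
    by uniqueness it is skew-Hermitian ([lyap_sol_skew]).  The right-hand side
    of the continuity equation is therefore unchanged.  Write
    [m = (v + e) rho].  The Lyapunov equation says exactly that the blocks of
    [e rho] are Hermitian, so the cross terms of [Q_rho (v + e)], which pair
    the skew-Hermitian [v] with the Hermitian [e rho], cancel, and
    [2 F (rho, m) = Q_rho v + Q_rho e >= Q_rho v]
    ([Q_form_skew_velocity_le]).  Finally [v] is a Borel function of time:
    by Cramer's rule its entries are rational functions, without poles, of the
    real and imaginary parts of the entries of [rho] and [m]
    ([mxmeasurable_skew_velocity]). *)

Set Implicit Arguments.
Unset Strict Implicit.
Unset Printing Implicit Defensive.

Import Order.TTheory GRing.Theory Num.Theory.

Local Open Scope classical_set_scope.
Local Open Scope sesquilinear_scope.
Local Open Scope complex_scope.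
Local Open Scope ring_scope.

(** * Adjoints and positive definite matrices *)

Lemma adjmxM (C : numClosedFieldType) (m n p : nat)
    (A : 'M[C]_(m, n)) (B : 'M[C]_(n, p)) :
  (A *m B)^t* = B^t* *m A^t*.
Proof. by rewrite trmx_mul map_mxM. Qed.

Lemma adjmxD (C : numClosedFieldType) (m n : nat) (A B : 'M[C]_(m, n)) :
  (A + B)^t* = A^t* + B^t*.
Proof. by rewrite raddfD /= map_mxD. Qed.

Lemma adjmxN (C : numClosedFieldType) (m n : nat) (A : 'M[C]_(m, n)) :
  (- A)^t* = - A^t*.
Proof. by rewrite raddfN /= map_mxN. Qed.

Lemma hermitianM_adj (C : numClosedFieldType) (n : nat) (A : 'M[C]_n) :
  A \is hermitianM -> A^t* = A.
Proof. by move/is_hermitianmxP; rewrite expr0 scale1r => <-. Qed.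

Lemma skewHermitianM_adj (C : numClosedFieldType) (n : nat) (A : 'M[C]_n) :
  A \is skewHermitianM <-> A^t* = - A.
Proof.
split=> [/is_hermitianmxP|h].
  by rewrite expr1 scaleN1r => {2}->; rewrite opprK.
by apply/is_hermitianmxP; rewrite expr1 scaleN1r h opprK.
Qed.

Lemma unitmx_ker0 (K : fieldType) (n : nat) (A : 'M[K]_n) :
  (forall u : 'rV_n, u *m A = 0 -> u = 0) -> A \in unitmx.
Proof.
move=> h; rewrite -row_free_unit -kermx_eq0; apply/eqP/row_matrixP => i.
by rewrite row0; apply: h; rewrite -row_mul mulmx_ker row0.
Qed.

(** The trace is the sum of the values of the quadratic form of [P] at the
    columns of [V]. *)
Lemma posdef_mxtrace (R : realType) (n p : nat) (P : 'M[R[i]]_n)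
    (V : 'M[R[i]]_(n, p)) (hP : posdefM P) :
  0 <= \tr (V^t* *m P *m V) ?= iff (V == 0).
Proof.
have [_ Ppos] := hP.
have diagE j : (V^t* *m P *m V) j j = ((col j V)^t* *m P *m col j V) 0 0.
  rewrite !mxE; apply: eq_bigr => k _; rewrite !mxE; congr (_ * _).
  by apply: eq_bigr => l _; rewrite !mxE.
have diag_ge0 j : 0 <= (V^t* *m P *m V) j j.
  rewrite diagE; have [->|/Ppos/ltW//] := eqVneq (col j V) 0.
  by rewrite mulmx0 mxE.
split; first by apply: sumr_ge0 => j _.
rewrite eq_sym; apply/eqP/eqP => [tr0|->]; last by rewrite mulmx0 mxtrace0.
apply/matrixP => i j; rewrite [RHS]mxE.
have /psumr_eq0P /(_ tr0) /(_ j isT) :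
    forall j, true -> 0 <= (V^t* *m P *m V) j j by [].
have [/matrixP/(_ i 0)|/Ppos] := eqVneq (col j V) 0; first by rewrite !mxE.
by rewrite -diagE => /lt0r_neq0 /eqP.
Qed.

Lemma posdef_unitmx (R : realType) (n : nat) (P : 'M[R[i]]_n) :
  posdefM P -> P \in unitmx.
Proof.
move=> hP; apply: unitmx_ker0 => u uP0.
have [_ /esym] := posdef_mxtrace (u^t*) hP.
rewrite trmxCK uP0 mul0mx mxtrace0 eqxx => /eqP u0.
by rewrite -[u]trmxCK u0 trmx0 map_mx0.
Qed.

(** * The Lyapunov equation *)

(** Matrix of the Lyapunov operator [V |-> V P + P V], acting on the right of
    the row vectors [mxvec V]. *)
Definition lyap_mx (K : comPzRingType) (n : nat) (P : 'M[K]_n) :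
    'M[K]_(n * n) :=
  lin_mulmxr P + lin_mulmx P.

Lemma mul_lyap_mx (K : comPzRingType) (n : nat) (P V : 'M[K]_n) :
  mxvec V *m lyap_mx P = mxvec (V *m P + P *m V).
Proof. by rewrite mulmxDr !mul_vec_lin linearD. Qed.

(** Multiplying the equation by [V^*] and taking traces gives a sum of two
    nonnegative terms, the second of which vanishes only for [V = 0]. *)
Lemma lyapunov_inj (R : realType) (n : nat) (P V : 'M[R[i]]_n) :
  posdefM P -> V *m P + P *m V = 0 -> V = 0.
Proof.
move=> hP V0; have [ge0 eq0] := posdef_mxtrace V hP.
have [ge0' _] := posdef_mxtrace (V^t*) hP; rewrite trmxCK in ge0'.
have : \tr (V *m P *m V^t*) + \tr (V^t* *m P *m V) = 0.
  by rewrite mxtrace_mulC -mulmxA -mxtraceD -mulmxDr V0 mulmx0 mxtrace0.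
move=> /eqP; rewrite paddr_eq0// => /andP[_ /eqP tr0].
by apply/eqP; rewrite -eq0 tr0.
Qed.

Lemma lyap_mx_unit (R : realType) (n : nat) (P : 'M[R[i]]_n) :
  posdefM P -> lyap_mx P \in unitmx.
Proof.
move=> hP; apply: unitmx_ker0 => u; rewrite -[u]vec_mxK mul_lyap_mx.
move=> /(congr1 vec_mx); rewrite mxvecK linear0 => /(lyapunov_inj hP) ->.
by rewrite linear0.
Qed.

(** The solution [V] of [V P + P V = W], meaningful when [lyap_mx P] is
    invertible, in particular for positive definite [P]. *)
Definition lyap_sol (R : realType) (n : nat) (P W : 'M[R[i]]_n) : 'M[R[i]]_n :=
  vec_mx (mxvec W *m invmx (lyap_mx P)).

Lemma lyap_solP (R : realType) (n : nat) (P W : 'M[R[i]]_n) :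
  posdefM P -> lyap_sol P W *m P + P *m lyap_sol P W = W.
Proof.
move=> hP; apply: (can_inj mxvecK).
by rewrite -mul_lyap_mx vec_mxK mulmxKV// lyap_mx_unit.
Qed.

(** [- V^*] solves the same equation as [V]. *)
Lemma lyap_sol_skew (R : realType) (n : nat) (P W : 'M[R[i]]_n) :
  posdefM P -> W^t* = - W -> lyap_sol P W \is skewHermitianM.
Proof.
move=> hP Wskew; set V := lyap_sol P W.
have VE : V *m P + P *m V = W by exact: lyap_solP.
have Pherm : P^t* = P by apply: hermitianM_adj; case: hP.
apply/skewHermitianM_adj/eqP; rewrite -addr_eq0; apply/eqP.
have VtE : V^t* *m P + P *m V^t* = - W.
  by rewrite -Wskew -VE adjmxD !adjmxM Pherm addrC.
by apply: (lyapunov_inj hP); rewrite mulmxDl mulmxDr addrACA VE VtE addNr.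
Qed.

(** * Comparison of the two costs at a fixed time *)

Section cost.
Variables (R : realType) (N n : nat).
Implicit Types (P : 'M[R[i]]_n) (u v m : blockcol R N n).

Lemma mxtrace_adj_mul_blocks u v :
  \tr (u^t* *m v) = \sum_(k < N) \tr ((submxcol u k)^t* *m submxcol v k).
Proof.
rewrite -[in LHS](submxcolK u) -[in LHS](submxcolK v).
rewrite tr_mxcol.
have -> : map_mx Num.conj (\mxrow_(k < N) (submxcol u k)^T) =
  \mxrow_(k < N) (submxcol u k)^t*.
  by apply/matrixP => a b; rewrite !mxE.
by rewrite mul_mxrow_mxcol raddf_sum.
Qed.

(** Here [u] need not have skew-Hermitian blocks. *)
Lemma F_cost_velocity P u : posdefM P -> F_cost P (u *m P) = 2^-1 * Q_form P u.
Proof.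
move=> hP; rewrite /F_cost /Q_form /inner mulmxK ?posdef_unitmx//.
by rewrite adjmxM hermitianM_adj ?mulmxA//; case: hP.
Qed.

Lemma ReD (x y : R[i]) : complex.Re (x + y) = complex.Re x + complex.Re y.
Proof. by case: x y => [? ?] [? ?]. Qed.

Lemma Q_form_ge0 P v : posdefM P -> 0 <= Q_form P v.
Proof.
move=> hP; have [ge0 _] := posdef_mxtrace (v^t* ) hP.
rewrite /Q_form mulmxA mxtrace_mulC mulmxA -{1}[v]trmxCK.
by move: ge0; rewrite lecE => /andP[].
Qed.

Lemma Q_formD P v w :
  Q_form P (v + w) = Q_form P v + Q_form P w +
    complex.Re (\tr (P *m (v^t* *m w)) + \tr (P *m (w^t* *m v))).
Proof.
rewrite /Q_form -!ReD; congr complex.Re.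
rewrite adjmxD mulmxDl !mulmxDr !mxtraceD -!addrA; congr (_ + _).
by rewrite addrA addrC.
Qed.

Lemma adj_sub_velocity P v : posdefM P -> skew_blocks v ->
  v *m P - adj_blocks (v *m P) = v *m P + lmul_blocks P v.
Proof.
move=> hP vskew; congr (_ + _); rewrite -mxcolN.
apply: eq_mxcol => k; rewrite -submxcol_mul adjmxM.
have /skewHermitianM_adj -> := vskew k.
by rewrite mulmxN opprK hermitianM_adj//; case: hP.
Qed.

(** The velocity with skew-Hermitian blocks associated with the momentum [m]:
    the one that gives the same flux [m - m_*]. *)
Definition skew_velocity P m : blockcol R N n :=
  \mxcol_(k < N) lyap_sol P (submxcol m k - (submxcol m k)^t* ).

Lemma skew_velocity_skew P m : posdefM P -> skew_blocks (skew_velocity P m).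
Proof.
move=> hP k; rewrite mxcolK; apply: lyap_sol_skew => //.
by rewrite adjmxD adjmxN trmxCK opprB addrC.
Qed.

Lemma skew_velocityE P m : posdefM P ->
  skew_velocity P m *m P + lmul_blocks P (skew_velocity P m) = m - adj_blocks m.
Proof.
move=> hP; apply/mxcolP => k.
rewrite submxcolD submxcolB -submxcol_mul !mxcolK.
exact: lyap_solP.
Qed.

(** Among the columns [u] for which [u P] has the flux [m - m_*], the one with
    skew-Hermitian blocks minimizes [Q_form P]. *)
Lemma Q_form_skew_velocity_le P m : posdefM P ->
  Q_form P (skew_velocity P m) <= 2 * F_cost P m.
Proof.
move=> hP; set v := skew_velocity P m.
have Pu := posdef_unitmx hP.
have Pherm : P^t* = P by apply: hermitianM_adj; case: hP.
(* The velocity [m P^-1] splits as [v + e]. *)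
set e := m *m invmx P - v.
have -> : m = (v + e) *m P by rewrite /e addrC subrK mulmxKV.
rewrite F_cost_velocity// mulVKf ?pnatr_eq0//.
suff cross : \tr (P *m (v^t* *m e)) + \tr (P *m (e^t* *m v)) = 0.
  by rewrite Q_formD cross /= addr0 lerDl Q_form_ge0.
have -> : \tr (P *m (v^t* *m e)) = \tr (v^t* *m (e *m P)).
  by rewrite mxtrace_mulC mulmxA.
have -> : \tr (P *m (e^t* *m v)) = \tr ((e *m P)^t* *m v).
  by rewrite adjmxM Pherm mulmxA.
rewrite !mxtrace_adj_mul_blocks -big_split big1// => k _ /=.
have /skewHermitianM_adj -> := skew_velocity_skew m hP k.
(* The blocks of [e P] are Hermitian, so the two pairings cancel. *)
have -> : (submxcol (e *m P) k)^t* = submxcol (e *m P) k.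
  rewrite mulmxBl mulmxKV// submxcolB -submxcol_mul.
  set mk := submxcol m k; set vk := submxcol v k.
  have vkE : vk *m P + P *m vk = mk - mk^t*.
    by rewrite /vk /v mxcolK lyap_solP.
  have vk_skew : vk^t* = - vk.
    exact/skewHermitianM_adj/(skew_velocity_skew m hP k).
  rewrite adjmxD adjmxN adjmxM Pherm vk_skew mulmxN opprK.
  apply/eqP; rewrite eq_sym subr_eq -addrA [P *m vk + _]addrC vkE.
  by rewrite addrC subrK.
by rewrite mulNmx raddfN [X in _ + X]mxtrace_mulC addNr.
Qed.
End cost.

(** * Measurability of complex matrix-valued functions *)

Section complex_measurability.
Context (d : measure_display) (T : measurableType d) (R : realType).
Variable D : set T.

(** Measurability of a complex function, read on its real and imaginary
    parts. *)
Definition cmeasurable (f : T -> R[i]) : Prop :=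
  measurable_fun D (fun t => complex.Re (f t)) /\
  measurable_fun D (fun t => complex.Im (f t)).

Lemma eq_cmeasurable (f g : T -> R[i]) :
  (forall t, D t -> f t = g t) -> cmeasurable f -> cmeasurable g.
Proof.
move=> fg [fRe fIm]; split.
  by apply: eq_measurable_fun fRe => t /set_mem Dt; rewrite fg.
by apply: eq_measurable_fun fIm => t /set_mem Dt; rewrite fg.
Qed.

Lemma cmeasurable_cst (z : R[i]) : cmeasurable (fun=> z).
Proof. by split; exact: measurable_cst. Qed.

Lemma cmeasurableD (f g : T -> R[i]) :
  cmeasurable f -> cmeasurable g -> cmeasurable (fun t => f t + g t).
Proof.
move=> [fRe fIm] [gRe gIm]; split.
  apply: eq_measurable_fun (measurable_funD fRe gRe) => t _ /=.
  by case: (f t) (g t) => [? ?] [? ?].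
apply: eq_measurable_fun (measurable_funD fIm gIm) => t _ /=.
by case: (f t) (g t) => [? ?] [? ?].
Qed.

Lemma cmeasurableM (f g : T -> R[i]) :
  cmeasurable f -> cmeasurable g -> cmeasurable (fun t => f t * g t).
Proof.
move=> [fRe fIm] [gRe gIm]; split.
  apply: eq_measurable_fun
    (measurable_funB (measurable_funM fRe gRe) (measurable_funM fIm gIm)).
  by move=> t _ /=; case: (f t) (g t) => [? ?] [? ?].
apply: eq_measurable_fun
  (measurable_funD (measurable_funM fRe gIm) (measurable_funM fIm gRe)).
by move=> t _ /=; case: (f t) (g t) => [? ?] [? ?].
Qed.

Lemma cmeasurable_conj (f : T -> R[i]) :
  cmeasurable f -> cmeasurable (fun t => Num.conj (f t)).
Proof.
move=> [fRe fIm]; split.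
  by apply: eq_measurable_fun fRe => t _; case: (f t).
apply: eq_measurable_fun (measurableT_comp (@oppr_measurable R setT) fIm).
by move=> t _ /=; case: (f t).
Qed.

(** Nonnegativity allows the inverse to be read as the power [-1]. *)
Lemma measurable_fun_invr (f : T -> R) : (forall t, 0 <= f t) ->
  measurable_fun D f -> measurable_fun D (fun t => (f t)^-1).
Proof.
move=> f0 mf.
apply: eq_measurable_fun (measurableT_comp (@measurable_powR R (-1)) mf).
by move=> t _ /=; rewrite powR_inv1.
Qed.

Lemma cmeasurableV (f : T -> R[i]) :
  cmeasurable f -> cmeasurable (fun t => (f t)^-1).
Proof.
move=> [fRe fIm].
have mV : measurable_fun D
    (fun t => (complex.Re (f t) ^+ 2 + complex.Im (f t) ^+ 2)^-1).
  apply: measurable_fun_invr => [t|]; first by rewrite addr_ge0 ?sqr_ge0.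
  by apply: measurable_funD; exact: measurable_funX.
split.
  apply: eq_measurable_fun (measurable_funM fRe mV) => t _ /=.
  by case: (f t).
apply: eq_measurable_fun (measurableT_comp (@oppr_measurable R setT)
  (measurable_funM fIm mV)) => t _ /=.
by case: (f t).
Qed.

Lemma cmeasurable_sum (I : Type) (s : seq I) (p : pred I)
    (f : I -> T -> R[i]) :
  (forall i, cmeasurable (f i)) ->
  cmeasurable (fun t => \sum_(i <- s | p i) f i t).
Proof.
move=> mf; elim: s => [|i s IH].
  by apply: eq_cmeasurable (cmeasurable_cst 0) => t _; rewrite big_nil.
case pi : (p i).
  by apply: eq_cmeasurable (cmeasurableD (mf i) IH) => t _; rewrite big_cons pi.
by apply: eq_cmeasurable IH => t _; rewrite big_cons pi.
Qed.

Lemma cmeasurable_prod (I : Type) (s : seq I) (p : pred I)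
    (f : I -> T -> R[i]) :
  (forall i, cmeasurable (f i)) ->
  cmeasurable (fun t => \prod_(i <- s | p i) f i t).
Proof.
move=> mf; elim: s => [|i s IH].
  by apply: eq_cmeasurable (cmeasurable_cst 1) => t _; rewrite big_nil.
case pi : (p i).
  by apply: eq_cmeasurable (cmeasurableM (mf i) IH) => t _; rewrite big_cons pi.
by apply: eq_cmeasurable IH => t _; rewrite big_cons pi.
Qed.

(** Entrywise measurability; over [D = ]0, 1[] it is [borel_mx01] by
    definition. *)
Definition mxmeasurable (m n : nat) (A : T -> 'M[R[i]]_(m, n)) : Prop :=
  forall i j, cmeasurable (fun t => A t i j).

Lemma mxmeasurable_cst (m n : nat) (A : 'M[R[i]]_(m, n)) :
  mxmeasurable (fun=> A).
Proof. by move=> i j; exact: cmeasurable_cst. Qed.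

Lemma mxmeasurableD (m n : nat) (A B : T -> 'M[R[i]]_(m, n)) :
  mxmeasurable A -> mxmeasurable B -> mxmeasurable (fun t => A t + B t).
Proof.
move=> mA mB i j; apply: eq_cmeasurable (cmeasurableD (mA i j) (mB i j)) => t _.
by rewrite mxE.
Qed.

Lemma mxmeasurableZ (m n : nat) (f : T -> R[i]) (A : T -> 'M[R[i]]_(m, n)) :
  cmeasurable f -> mxmeasurable A -> mxmeasurable (fun t => f t *: A t).
Proof.
move=> mf mA i j; apply: eq_cmeasurable (cmeasurableM mf (mA i j)) => t _.
by rewrite mxE.
Qed.

Lemma mxmeasurableM (m n p : nat)
    (A : T -> 'M[R[i]]_(m, n)) (B : T -> 'M[R[i]]_(n, p)) :
  mxmeasurable A -> mxmeasurable B -> mxmeasurable (fun t => A t *m B t).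
Proof.
move=> mA mB i j.
apply: eq_cmeasurable (cmeasurable_sum (index_enum _) xpredT
  (fun k => cmeasurableM (mA i k) (mB k j))) => t _.
by rewrite mxE.
Qed.

Lemma mxmeasurable_adj (m n : nat) (A : T -> 'M[R[i]]_(m, n)) :
  mxmeasurable A -> mxmeasurable (fun t => (A t)^t*).
Proof.
move=> mA i j; apply: eq_cmeasurable (cmeasurable_conj (mA j i)) => t _.
by rewrite !mxE.
Qed.

Lemma mxmeasurable_mxvec (m n : nat) (A : T -> 'M[R[i]]_(m, n)) :
  mxmeasurable A -> mxmeasurable (fun t => mxvec (A t)).
Proof.
move=> mA i k; case/mxvec_indexP: k => a b.
by apply: eq_cmeasurable (mA a b) => t _; rewrite ord1 mxvecE.
Qed.

Lemma mxmeasurable_vec_mx (m n : nat) (A : T -> 'rV[R[i]]_(m * n)) :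
  mxmeasurable A -> mxmeasurable (fun t => vec_mx (A t)).
Proof.
move=> mA i j; apply: eq_cmeasurable (mA 0 (mxvec_index i j)) => t _.
by rewrite mxE.
Qed.

Lemma cmeasurable_mxtrace (n : nat) (A : T -> 'M[R[i]]_n) :
  mxmeasurable A -> cmeasurable (fun t => \tr (A t)).
Proof. by move=> mA; apply: cmeasurable_sum => i; exact: mA. Qed.

Lemma cmeasurable_det (n : nat) (A : T -> 'M[R[i]]_n) :
  mxmeasurable A -> cmeasurable (fun t => \det (A t)).
Proof.
move=> mA; apply: cmeasurable_sum => s.
apply: cmeasurableM; first exact: cmeasurable_cst.
by apply: cmeasurable_prod => i; exact: mA.
Qed.

Lemma mxmeasurable_adjugate (n : nat) (A : T -> 'M[R[i]]_n) :
  mxmeasurable A -> mxmeasurable (fun t => \adj (A t)).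
Proof.
move=> mA i j.
apply: (@eq_cmeasurable (fun t =>
  (-1) ^+ (j + i) * \det (row' j (col' i (A t))))).
  by move=> t _; rewrite mxE.
apply: cmeasurableM; first exact: cmeasurable_cst.
apply: cmeasurable_det => a b.
by apply: eq_cmeasurable (mA (lift j a) (lift i b)) => t _; rewrite !mxE.
Qed.

(** Cramer's rule. *)
Lemma mxmeasurable_invmx (n : nat) (A : T -> 'M[R[i]]_n) :
  (forall t, D t -> A t \in unitmx) ->
  mxmeasurable A -> mxmeasurable (fun t => invmx (A t)).
Proof.
move=> uA mA i j.
apply: (@eq_cmeasurable (fun t => ((\det (A t))^-1 *: \adj (A t)) i j)).
  by move=> t Dt; rewrite /invmx uA.
apply: (mxmeasurableZ _ (mxmeasurable_adjugate mA)).
exact/cmeasurableV/cmeasurable_det.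
Qed.

Lemma mxmeasurable_submxcol (N n m : nat)
    (A : T -> 'M[R[i]]_(\sum_(k < N) n, m)) k :
  mxmeasurable A -> mxmeasurable (fun t => submxcol (A t) k).
Proof.
move=> mA i j; apply: eq_cmeasurable (mA (tagnat.Rank k i) j) => t _.
by rewrite mxE.
Qed.

Lemma mxmeasurable_mxcol (N n m : nat) (A : 'I_N -> T -> 'M[R[i]]_(n, m)) :
  (forall k, mxmeasurable (A k)) ->
  mxmeasurable (fun t => \mxcol_(k < N) A k t).
Proof.
move=> mA i j.
apply: eq_cmeasurable (mA (tagnat.sig1 i) (tagnat.sig2 i) j) => t _.
by rewrite mxE.
Qed.

Lemma mxmeasurable_lyap_mx (n : nat) (P : T -> 'M[R[i]]_n) :
  mxmeasurable P -> mxmeasurable (fun t => lyap_mx (P t)).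
Proof.
move=> mP i j.
(* Row [i] of [lyap_mx P] is the image of the [i]-th basis vector. *)
pose E : 'M[R[i]]_n := vec_mx (delta_mx 0 i).
apply: (@eq_cmeasurable (fun t => mxvec (E *m P t + P t *m E) 0 j)).
  by move=> t _; rewrite -mul_lyap_mx vec_mxK -rowE mxE.
apply: mxmeasurable_mxvec; apply: mxmeasurableD; apply: mxmeasurableM => //;
  exact: mxmeasurable_cst.
Qed.

Lemma mxmeasurable_skew_velocity (N n : nat) (P : T -> 'M[R[i]]_n)
    (m : T -> blockcol R N n) :
  (forall t, D t -> posdefM (P t)) -> mxmeasurable P -> mxmeasurable m ->
  mxmeasurable (fun t => skew_velocity (P t) (m t)).
Proof.
move=> hP mP mm; apply: mxmeasurable_mxcol => k.
have mmk := mxmeasurable_submxcol k mm.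
apply: mxmeasurable_vec_mx; apply: mxmeasurableM.
  apply: mxmeasurable_mxvec; apply: mxmeasurableD => //.
  move=> i j; apply: eq_cmeasurable (mxmeasurableZ (cmeasurable_cst (-1))
    (mxmeasurable_adj mmk) i j) => t _.
  by rewrite scaleN1r.
apply: mxmeasurable_invmx; last exact: mxmeasurable_lyap_mx.
by move=> t /hP; exact: lyap_mx_unit.
Qed.

Lemma measurable_Q_form (N n : nat) (P : T -> 'M[R[i]]_n)
    (v : T -> blockcol R N n) :
  mxmeasurable P -> mxmeasurable v ->
  measurable_fun D (fun t => Q_form (P t) (v t)).
Proof.
move=> mP mv; apply: (cmeasurable_mxtrace _).1.
by do 2?[apply: mxmeasurableM => //]; exact: mxmeasurable_adj.
Qed.

End complex_measurability.

(** * Integrability and distributional derivatives on the unit interval *)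

Lemma L1_01Z (R : realType) (k : R) (f : R -> R) :
  L1_01 f -> L1_01 (fun t => k * f t).
Proof.
rewrite /L1_01 => fint.
have mI : measurable (`]0%R, 1%R[ : set (measurableTypeR R)).
  exact: measurable_itv.
by have := integrableZl mI k fint. 
Qed.

Lemma L1_01_le (R : realType) (f g : R -> R) :
  measurable_fun (`]0%R, 1%R[%classic : set R) f ->
  (forall t, `]0%R, 1%R[%classic t -> 0 <= f t <= g t) -> L1_01 g -> L1_01 f.
Proof.
rewrite /L1_01 => mf fg gint.
have mI : measurable (`]0%R, 1%R[ : set (measurableTypeR R)).
  exact: measurable_itv.
apply: (le_integrable mI _ _ gint); first exact/measurable_EFinP.
move=> t /fg /andP[f0 fg'] /=; rewrite lee_fin ger0_norm//.
exact: le_trans fg' (ler_norm _).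
Qed.

Lemma eq_L1_01 (R : realType) (f g : R -> R) :
  (forall t, `]0%R, 1%R[%classic t -> f t = g t) -> L1_01 f -> L1_01 g.
Proof.
rewrite /L1_01 => fg; apply: eq_integrable; first exact: measurable_itv.
by move=> t /set_mem /fg /= ->.
Qed.

Lemma eq_distr_deriv01 (R : realType) (f g h : R -> R) :
  (forall t, `]0, 1[%classic t -> g t = h t) ->
  distr_deriv01 f g -> distr_deriv01 f h.
Proof.
move=> gh [fint [mg oI gint] fg]; split=> //.
  split=> // [|K KI cK].
    by apply: eq_measurable_fun mg => t /set_mem /gh.
  apply: le_lt_trans (gint K KI cK); rewrite le_eqVlt; apply/orP; left.
  by apply/eqP; apply: eq_integral => t /set_mem /KI /gh ->.
move=> phi /fg ->; congr (- _)%E.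
by apply: eq_integral => t /set_mem /gh ->.
Qed.

Lemma eq_distr_deriv_mx01 (R : realType) (p q : nat)
    (A B C : R -> 'M[R[i]]_(p, q)) :
  (forall t, `]0, 1[%classic t -> B t = C t) ->
  distr_deriv_mx01 A B -> distr_deriv_mx01 A C.
Proof.
move=> BC AB i j; have [ABRe ABIm] := AB i j.
by split; [move: ABRe|move: ABIm]; apply: eq_distr_deriv01 => t /BC ->.
Qed.

(** The local integrability required of a curve that has a distributional
    derivative includes its measurability. *)
Lemma distr_deriv_mx01_measurable (R : realType) (p q : nat)
    (A B : R -> 'M[R[i]]_(p, q)) : distr_deriv_mx01 A B -> borel_mx01 A.
Proof. by move=> AB i j; have [[[? _ _] _ _] [[? _ _] _ _]] := AB i j. Qed.

(** * Passing between velocities and momenta *)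

Section admissible.
Variables (R : realType) (n N : nat) (L : 'I_N -> 'M[R[i]]_n).
Variables (rho0 rho1 : 'M[R[i]]_n).

Lemma density_path_posdef (rho : R -> 'M[R[i]]_n) (t : R) :
  density_path rho0 rho1 rho -> `]0, 1[%classic t -> posdefM (rho t).
Proof.
move=> [_ dens _ _]; rewrite /= in_itv /= => /andP[t0 t1].
suff /dens[] : `[0, 1]%classic t by [].
by rewrite /= in_itv /= !ltW.
Qed.

Lemma admissible_momentum (rho : R -> 'M[R[i]]_n) (v : R -> blockcol R N n) :
  admissible_v L rho0 rho1 (rho, v) ->
  admissible_m L rho0 rho1 (rho, fun t => v t *m rho t).
Proof.
move=> [/= path vskew vborel Qint deriv].
have hrho t : `]0, 1[%classic t -> posdefM (rho t).
  by move=> ht; exact: density_path_posdef path ht.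
have mrho := distr_deriv_mx01_measurable deriv.
split; first exact: path.
- exact: (mxmeasurableM vborel mrho).
- apply: eq_L1_01 (L1_01Z 2^-1 Qint) => t /hrho rhot.
  by rewrite F_cost_velocity.
- apply: eq_distr_deriv_mx01 deriv => t ht.
  by rewrite adj_sub_velocity//; [exact: hrho|exact: vskew].
Qed.

Lemma admissible_skew_velocity (rho : R -> 'M[R[i]]_n)
    (m : R -> blockcol R N n) :
  admissible_m L rho0 rho1 (rho, m) ->
  admissible_v L rho0 rho1 (rho, fun t => skew_velocity (rho t) (m t)).
Proof.
move=> [/= path mborel Fint deriv].
have hrho t : `]0, 1[%classic t -> posdefM (rho t).
  by move=> ht; exact: density_path_posdef path ht.
have mrho := distr_deriv_mx01_measurable deriv.
have vborel := mxmeasurable_skew_velocity hrho mrho mborel.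
split; first exact: path.
- by move=> t /hrho; exact: skew_velocity_skew.
- exact: vborel.
- apply: L1_01_le (L1_01Z 2 Fint); first exact: measurable_Q_form.
  by move=> t /hrho rhot; rewrite Q_form_ge0 ?Q_form_skew_velocity_le.
- by apply: eq_distr_deriv_mx01 deriv => t /hrho rhot; rewrite skew_velocityE.
Qed.

End admissible.

Theorem lemma10 (R : realType) (n N : nat) (hn : (1 <= n)%N) (hN : (1 <= N)%N)
    (L : 'I_N -> 'M[R[i]]_n) (hL : forall k : 'I_N, L k \is hermitianM)
    (rho0 rho1 : 'M[R[i]]_n) (h0 : densityM rho0) (h1 : densityM rho1) :
  ereal_inf
    [set (\int[lebesgue_measure]_(t in `]0%R, 1%R[)
            (2^-1 * Q_form (rv.1 t) (rv.2 t))%:E)%E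
     | rv in admissible_v L rho0 rho1] =
  ereal_inf
    [set (\int[lebesgue_measure]_(t in `]0%R, 1%R[)
            (F_cost (rm.1 t) (rm.2 t))%:E)%E
     | rm in admissible_m L rho0 rho1].
Proof.
apply/eqP; rewrite eq_le; apply/andP; split;
  apply/ereal_infP => _ [[rho w] /= adm <-];
  have path : density_path rho0 rho1 rho by case: adm.
- have vadm := admissible_skew_velocity adm.
  apply: ge_ereal_inf; eexists.
    by exists (rho, fun t => skew_velocity (rho t) (w t)).
  have [_ _ _ Qint _] := vadm; have [_ _ Fint _] := adm.
  apply: ge0_le_integral; first exact: measurable_itv.
  + move=> t /(density_path_posdef path) rhot.
    by rewrite lee_fin mulr_ge0 ?invr_ge0 ?ler0n ?Q_form_ge0.
  + exact: measurable_int (L1_01Z 2^-1 Qint).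
  + exact: measurable_int Fint.
  + move=> t /(density_path_posdef path) rhot.
    by rewrite lee_fin ler_pdivrMl ?ltr0n ?Q_form_skew_velocity_le.
- apply: ge_ereal_inf; eexists.
    by exists (rho, fun t => w t *m rho t); first exact: admissible_momentum.
  rewrite le_eqVlt; apply/orP; left; apply/eqP.
  apply: eq_integral => t /set_mem ht.
  rewrite /fst /snd F_cost_velocity//; exact: density_path_posdef path ht.
Qed.
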